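(* Let $A\in\mathbb{R}^{m\times n}$ be a full column-rank matrix. Then $$\chi(A)=\max_{S\in\mathscr{S}} H(SA)=H(\mathbf{A}),$$ where $\mathbf{A}:=\begin{bmatrix}A\\-A\end{bmatrix}\in\mathbb{R}^{2m\times n}$. Furthermore, if all rows of $A$ are nonzero, then $$\chi(A)=\max\left\{H(SA): S\in\mathscr{S},\ SA(\mathbb{R}^n)\cap\mathbb{R}^m_{++}\neq\emptyset\right\}.$$
   Context: Here $m,n\ge 1$; $\mathbb{R}^d$ carries the Euclidean norm $\|\cdot\|$ and matrices carry the induced operator norm $\|M\|=\max_{\|x\|\le 1}\|Mx\|$. $\mathbb{R}^m_+$ and $\mathbb{R}^m_{++}$ are the sets of vectors in $\mathbb{R}^m$ with nonnegative, respectively positive, entries. For a matrix $A$ with $n$ columns, $A(\mathbb{R}^n):=\{Ax:x\in\mathbb{R}^n\}$. $\mathscr{S}:=\{\operatorname{Diag}(s): s\in\{-1,1\}^m\}\subseteq\mathbb{R}^{m\times m}$ is the set of signature matrices and $\mathscr{D}:=\{\operatorname{Diag}(d): d\in\mathbb{R}^m_{++}\}$ is the set of diagonal matrices with positive diagonal entries. Chi constant: for $A\in\mathbb{R}^{m\times n}$ of full column rank and $D\in\mathscr{D}$, let $A_D^\dagger:=(A^{\mathsf T}DA)^{-1}A^{\mathsf T}D$, and define $$\chi(A):=\sup_{D\in\mathscr{D}}\|A_D^\dagger\|,$$ which is known to be finite. Hoffman constant: for any nonzero matrix $B\in\mathbb{R}^{p\times n}$ and $b\in\mathbb{R}^p$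 let $P_B(b):=\{x\in\mathbb{R}^n: Bx\le b\}$ (componentwise inequality), which is nonempty if and only if $b\in B(\mathbb{R}^n)+\mathbb{R}^p_+$. Define $$H(B):=\sup\left\{\frac{\operatorname{dist}(x,P_B(b))}{\|(Bx-b)_+\|}: b\in B(\mathbb{R}^n)+\mathbb{R}^p_+,\ x\in\mathbb{R}^n\setminus P_B(b)\right\},$$ which is known to be finite, where $\operatorname{dist}(u,T)=\inf_{v\in T}\|u-v\|$ and $(\cdot)_+$ is the componentwise positive part. *)

(* Defs.v *)
From mathcomp Require Import all_boot all_order all_algebra.
From mathcomp Require Import boolp classical_sets reals ereal.

Set Implicit Arguments.
Unset Strict Implicit.
Unset Printing Implicit Defensive.

Import Order.TTheory GRing.Theory Num.Theory.

Local Open Scope classical_set_scope.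
Local Open Scope ring_scope.

(* The norm that MathComp-Analysis puts on matrices is the maximum of the
   absolute values of the entries, hence a separate Euclidean norm. *)
Definition eucl_norm (R : realType) (d : nat) (x : 'cV[R]_d) : R :=
  Num.sqrt (\sum_i x i 0 ^+ 2).

(* The set is nonempty (it contains 0) and bounded above, so the real [sup]
   is a genuine supremum, and it is attained by compactness. *)
Definition opnorm (R : realType) (p q : nat) (M : 'M[R]_(p, q)) : R :=
  sup [set eucl_norm (M *m x) | x in [set x : 'cV[R]_q | eucl_norm x <= 1]].

Definition eucl_dist (R : realType) (d : nat)
    (u : 'cV[R]_d) (T : set 'cV[R]_d) : R :=
  inf [set eucl_norm (u - v) | v in T].

Definition pospart (R : realType) (d : nat) (x : 'cV[R]_d) : 'cV[R]_d :=
  \col_i Num.max (x i 0) 0.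

Definition nonneg_vec (R : realType) (d : nat) : set 'cV[R]_d :=
  [set x | forall i, 0 <= x i 0].
Arguments nonneg_vec : clear implicits.

Definition pos_vec (R : realType) (d : nat) : set 'cV[R]_d :=
  [set x | forall i, 0 < x i 0].
Arguments pos_vec : clear implicits.

Definition mximage (R : realType) (p q : nat) (M : 'M[R]_(p, q)) : set 'cV[R]_p :=
  range (fun x : 'cV[R]_q => M *m x).

Definition signature_mx (R : realType) (m : nat) : set 'M[R]_m :=
  [set diag_mx s | s in [set s : 'rV[R]_m | forall i, s 0 i = -1 \/ s 0 i = 1]].
Arguments signature_mx : clear implicits.

Definition posdiag_mx (R : realType) (m : nat) : set 'M[R]_m :=
  [set diag_mx d | d in [set d : 'rV[R]_m | forall i, 0 < d 0 i]].
Arguments posdiag_mx : clear implicits.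

Definition weighted_pinv (R : realType) (m n : nat)
    (A : 'M[R]_(m, n)) (D : 'M[R]_m) : 'M[R]_(n, m) :=
  invmx (A^T *m D *m A) *m A^T *m D.

(* [chi] and [hoffman] are suprema in the extended reals, so that no default
   value is involved: neither definition presupposes finiteness. *)
Definition chi (R : realType) (m n : nat) (A : 'M[R]_(m, n)) : \bar R :=
  ereal_sup [set (opnorm (weighted_pinv A D))%:E | D in posdiag_mx R m].

Definition polyhedron (R : realType) (p n : nat)
    (B : 'M[R]_(p, n)) (b : 'cV[R]_p) : set 'cV[R]_n :=
  [set x | forall i, (B *m x) i 0 <= b i 0].

(* B(R^n) + R^p_+ *)
Definition feasible_rhs (R : realType) (p n : nat)
    (B : 'M[R]_(p, n)) : set 'cV[R]_p :=
  [set y + u | y in mximage B & u in nonneg_vec R p].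

Definition hoffman (R : realType) (p n : nat) (B : 'M[R]_(p, n)) : \bar R :=
  ereal_sup [set (eucl_dist bx.2 (polyhedron B bx.1)
                    / eucl_norm (pospart (B *m bx.2 - bx.1)))%:E
            | bx in [set bx : 'cV[R]_p * 'cV[R]_n |
                      feasible_rhs B bx.1 /\ ~ polyhedron B bx.1 bx.2]].

Definition is_max (R : realType) (E : set (\bar R)) (v : \bar R) : Prop :=
  E v /\ ubound E v.

(* Main.v *)
(* Write [a_i] for the rows of [A]. The proof closes the cycle
   H(SA) <= H([A; -A]) <= chi(A) <= max_S H(SA).
   - H([A; -A]) <= chi(A): if [y] is the point of the polyhedron nearest to [x],
     the KKT conditions and Caratheodory's theorem give [x - y = A^T l] with [l]
     supported on linearly independent active rows, so |x - y|^2 is at most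
     <l, g> for the residual [g]. The weighted pseudo-inverses with weights 1 on
     the support of [l] and tending to 0 elsewhere show that
     <l, g> <= chi(A) |A^T l| |g|.
   - chi(A) <= max_S H(SA): for [w := weighted_pinv A D *m g] there is [l] on
     linearly independent rows with [A^T l = w] and <l, g> >= |w|^2. Taking for
     [S] the signs of [l], every [y] with [s_i a_i y <= - s_i g_i] on the support
     of [l] satisfies <y, w> <= - |w|^2, hence has norm at least |w|.
   If the rows of [A] are nonzero, [S] can be taken to be the signs of some [A v]
   without zero entries. *)
Require Import Defs.
From mathcomp Require Import all_boot all_order all_algebra.
From mathcomp Require Import ring lra.
From mathcomp Require Import boolp classical_sets functions reals ereal.
From mathcomp Require Import topology normedtype derive.

Set Implicit Arguments.
Unset Strict Implicit.
Unset Printing Implicit Defensive.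

Import Order.TTheory GRing.Theory Num.Theory.
Import numFieldNormedType.Exports.

Local Open Scope classical_set_scope.
Local Open Scope ring_scope.

(** * Dot product of column vectors *)

Definition dotv (R : comNzRingType) (d : nat) (u v : 'cV[R]_d) : R :=
  (u^T *m v) 0 0.

Lemma dotvE (R : comNzRingType) (d : nat) (u v : 'cV[R]_d) :
  dotv u v = \sum_i u i 0 * v i 0.
Proof. by rewrite /dotv mxE; apply: eq_bigr => i _; rewrite mxE. Qed.

Lemma dotvC (R : comNzRingType) (d : nat) (u v : 'cV[R]_d) :
  dotv u v = dotv v u.
Proof. by rewrite !dotvE; apply: eq_bigr => i _; rewrite mulrC. Qed.

Lemma dotvDr (R : comNzRingType) (d : nat) (u v w : 'cV[R]_d) :
  dotv u (v + w) = dotv u v + dotv u w.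
Proof. by rewrite /dotv mulmxDr mxE. Qed.

Lemma dotvZr (R : comNzRingType) (d : nat) (u v : 'cV[R]_d) (a : R) :
  dotv u (a *: v) = a * dotv u v.
Proof. by rewrite /dotv -scalemxAr mxE. Qed.

Lemma dotvBr (R : comNzRingType) (d : nat) (u v w : 'cV[R]_d) :
  dotv u (v - w) = dotv u v - dotv u w.
Proof. by rewrite /dotv mulmxBr !mxE. Qed.

Lemma dotv0r (R : comNzRingType) (d : nat) (u : 'cV[R]_d) : dotv u 0 = 0.
Proof. by rewrite /dotv mulmx0 mxE. Qed.

Lemma dotvDl (R : comNzRingType) (d : nat) (u v w : 'cV[R]_d) :
  dotv (v + w) u = dotv v u + dotv w u.
Proof. by rewrite !(dotvC _ u) dotvDr. Qed.

Lemma dotvZl (R : comNzRingType) (d : nat) (u v : 'cV[R]_d) (a : R) :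
  dotv (a *: v) u = a * dotv v u.
Proof. by rewrite !(dotvC _ u) dotvZr. Qed.

Lemma dotvBl (R : comNzRingType) (d : nat) (u v w : 'cV[R]_d) :
  dotv (v - w) u = dotv v u - dotv w u.
Proof. by rewrite !(dotvC _ u) dotvBr. Qed.

Lemma dotvNl (R : comNzRingType) (d : nat) (u v : 'cV[R]_d) :
  dotv (- u) v = - dotv u v.
Proof. by rewrite -scaleN1r dotvZl mulN1r. Qed.

Lemma dotv_tr (R : comNzRingType) (p n : nat) (B : 'M[R]_(p, n))
    (l : 'cV[R]_p) (x : 'cV[R]_n) :
  dotv (B^T *m l) x = dotv l (B *m x).
Proof. by rewrite /dotv trmx_mul trmxK mulmxA. Qed.

Lemma dotv_ge0 (R : realFieldType) (d : nat) (u : 'cV[R]_d) : 0 <= dotv u u.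
Proof. by rewrite dotvE; apply: sumr_ge0 => i _; rewrite -expr2 sqr_ge0. Qed.

Lemma dotv_eq0 (R : realFieldType) (d : nat) (u : 'cV[R]_d) :
  (dotv u u == 0) = (u == 0).
Proof.
apply/eqP/eqP => [|->]; last exact: dotv0r.
rewrite dotvE => /psumr_eq0P u0; apply/colP => i; rewrite mxE.
have /eqP : u i 0 * u i 0 = 0 by apply: u0 => // j _; rewrite -expr2 sqr_ge0.
by rewrite mulf_eq0 orbb => /eqP.
Qed.

(** * Farkas' lemma and Caratheodory's reduction *)

Lemma mulmx_row_coord (R : comNzRingType) (p n : nat) (B : 'M[R]_(p, n))
    (k : 'I_p) (x : 'cV[R]_n) :
  row k B *m x = ((B *m x) k 0)%:M.
Proof.
by rewrite -row_mul; apply/rowP => j; rewrite !mxE ord1 eqxx mulr1n.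
Qed.

(** Induction on [#|J|]: a row [k] is removed and, if the direction found for the others violates
    it, eliminated by a projection. The argument is purely algebraic. *)
Lemma farkas (R : realFieldType) (p n : nat) (J : {set 'I_p})
    (B : 'M[R]_(p, n)) (c : 'cV[R]_n) :
  (exists l : 'cV[R]_p, [/\ forall i, 0 <= l i 0,
     forall i, i \notin J -> l i 0 = 0 & c = B^T *m l]) \/
  (exists d : 'cV[R]_n,
     (forall i, i \in J -> (B *m d) i 0 <= 0) /\ 0 < dotv c d).
Proof.
have [N] := ubnP #|J|; elim: N => // N IH in J B c *; rewrite ltnS => JN.
have [->|/set0Pn [k kJ]] := eqVneq J finset.set0.
  have [->|c0] := eqVneq c 0.
    by left; exists 0; split => [i|i _|]; rewrite ?mxE ?mulmx0.
  right; exists c; split=> [i|]; first by rewrite finset.in_set0.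
  by rewrite lt0r dotv_eq0 c0 dotv_ge0.
have J'N : (#|(J :\ k)%SET| < N)%N.
  by move: JN; rewrite (cardsD1 k) kJ.
have [[l [l0 lJ cE]]|[d [dJ cd]]] := IH _ B c J'N.
  left; exists l; split => // i iJ; apply: lJ.
  by rewrite in_setD1 negb_and iJ orbT.
have [dk|dk] := leP ((B *m d) k 0) 0.
  right; exists d; split => // i iJ.
  by have [->//|ik] := eqVneq i k; apply: dJ; rewrite in_setD1 ik.
set q := (B *m d) k 0 in dk.
have q0 : q != 0 by rewrite gt_eqF.
(* Project along the k-th row, parallel to [d]. *)
pose al := q^-1 *: (B *m d).
pose B' := B - al *m row k B.
pose c' := c - (dotv c d / q) *: (row k B)^T.
have [[l [l0 lJ cE]]|[d' [dJ' cd']]] := IH _ B' c' J'N.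
- left; pose ga := dotv c d / q - dotv al l.
  have lk : l k 0 = 0 by apply: lJ; rewrite in_setD1 eqxx.
  (* [dotv c d] is positive and [al] is nonpositive wherever [l] may be nonzero. *)
  have ga0 : 0 <= ga.
    rewrite subr_ge0; apply: (@le_trans _ _ 0); last first.
      by rewrite divr_ge0 // ltW.
    rewrite dotvE; apply: sumr_le0 => i _; rewrite mxE.
    have [iJ|iJ] := boolP (i \in (J :\ k)%SET); last by rewrite lJ ?mulr0.
    by rewrite mulr_le0_ge0 // mulr_ge0_le0 ?dJ // invr_ge0 ltW.
  exists (l + ga *: delta_mx k 0); split=> [i|i iJ|].
  + by rewrite !mxE addr_ge0 // mulr_ge0 // ler0n.
  + rewrite !mxE lJ ?in_setD1 ?negb_and ?iJ ?orbT // add0r.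
    by case: eqP iJ => [->|_]; rewrite ?kJ // mulr0.
  + rewrite mulmxDr -scalemxAr -colE -tr_row.
    have : c' = B^T *m l - dotv al l *: (row k B)^T.
      rewrite cE /B' linearB /= trmx_mul mulmxBl -mulmxA; congr (_ - _).
      by rewrite [al^T *m l]mx11_scalar mul_mx_scalar.
    rewrite /c' /ga scalerBl => /eqP; rewrite subr_eq => /eqP {1}->.
    by rewrite -!addrA; congr (_ + _); rewrite addrC.
(* Correcting [d'] along [d] puts it in the kernel of row [k]; [B] acts on the result as [B'] does
   on [d']. *)
- right; exists (d' - ((B *m d') k 0 / q) *: d).
  have BE i : (B *m (d' - ((B *m d') k 0 / q) *: d)) i 0 = (B' *m d') i 0.
    rewrite mulmxBr -scalemxAr mulmxBl -mulmxA mulmx_row_coord mul_mx_scalar.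
    by rewrite !mxE; congr (_ - _); rewrite mulrA.
  split=> [i iJ|].
    have [->|ik] := eqVneq i k; last by rewrite BE dJ' // in_setD1 ik.
    rewrite mulmxBr -scalemxAr; move: (B *m d') => v.
    by rewrite 3!mxE -/q divfK // subrr.
  suff -> : dotv c (d' - ((B *m d') k 0 / q) *: d) = dotv c' d' by [].
  rewrite /c' dotvBl dotvBr dotvZl dotvZr; congr (_ - _).
  by rewrite /(dotv (row k B)^T _) trmxK mulmx_row_coord [_%:M 0 0]mxE eqxx mulr1n; ring.
Qed.

(* The rows of [B] indexed by the support of [l] are linearly independent. *)
Definition indep_support (R : comNzRingType) (p n : nat)
    (B : 'M[R]_(p, n)) (l : 'cV[R]_p) : Prop :=
  forall mu : 'cV[R]_p, B^T *m mu = 0 ->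
    (forall i, l i 0 = 0 -> mu i 0 = 0) -> mu = 0.

(* The hypothesis on [mu] bounds [g] above on the orthant of [l], so that some
   solution of [B^T l' = B^T l] does at least as well as [l] on a basis. *)
Lemma caratheodory (R : realFieldType) (p n : nat) (B : 'M[R]_(p, n))
    (g l : 'cV[R]_p) :
  (forall mu : 'cV[R]_p, B^T *m mu = 0 ->
     (forall i, l i 0 = 0 -> mu i 0 = 0) -> 0 < dotv mu g ->
     exists i, l i 0 * mu i 0 < 0) ->
  exists l' : 'cV[R]_p,
    [/\ forall i, 0 <= l i 0 * l' i 0, forall i, l i 0 = 0 -> l' i 0 = 0,
        B^T *m l' = B^T *m l, dotv l g <= dotv l' g & indep_support B l'].
Proof.
have [N] := ubnP #|[set i | l i 0 != 0]%SET|.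
elim: N => // N IH in l *; rewrite ltnS => lN Hl.
have [ind|/existsNP [mu /not_implyP [mu0 /not_implyP [muS /eqP mun]]]] :=
    pselect (indep_support B l).
  by exists l; split=> // i; rewrite -expr2 sqr_ge0.
(* The hypothesis gives a sign conflict with [l] when [dotv mu g] is positive; if it is 0, one of
   [mu] and [- mu] conflicts with [l], because [mu] is nonzero. *)
wlog [mug [i0 mui0]] : mu mu0 muS {mun} /
    0 <= dotv mu g /\ exists i, l i 0 * mu i 0 < 0.
  move=> hw.
  have mN : B^T *m (- mu) = 0 by rewrite mulmxN mu0 oppr0.
  have mS i : l i 0 = 0 -> (- mu) i 0 = 0 by move/muS; rewrite mxE => ->; rewrite oppr0.
  have [gt0|lt0|eq0] := ltrgt0P (dotv mu g).
  - by apply: (hw mu) => //; split; [exact: ltW|exact: Hl].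
  - apply: (hw (- mu)) => //; rewrite dotvNl oppr_ge0; split; first exact: ltW.
    by apply: Hl => //; rewrite dotvNl oppr_gt0.
  - have [i mi] : exists i, mu i 0 != 0.
      apply/existsP; rewrite -negb_forall; apply: contra mun => /forallP h.
      by apply/eqP/colP => i; rewrite (eqP (h i)) mxE.
    have li : l i 0 != 0 by apply: contra_neq mi; exact: muS.
    have [neg|pos] := ltP (l i 0 * mu i 0) 0.
      by apply: (hw mu) => //; rewrite eq0; split => //; exists i.
    apply: (hw (- mu)) => //; rewrite dotvNl eq0 oppr0; split => //.
    by exists i; rewrite mxE mulrN oppr_lt0 lt_def pos mulf_neq0.
(* Ratio test: [t] is the first step length at which a conflicting coordinate of [l + t *: mu]
   reaches 0, so [j] leaves the support and no sign flips. *)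
pose F i := l i 0 / - mu i 0.
have [j muj jmin] := @arg_minP _ _ _ i0 (fun i => l i 0 * mu i 0 < 0) F mui0.
pose t := F j; pose l1 := l + t *: mu.
have l1E i : l1 i 0 = l i 0 + t * mu i 0 by rewrite !mxE.
have FE i : l i 0 * mu i 0 < 0 -> F i * (- (l i 0 * mu i 0)) = l i 0 ^+ 2.
  move=> h; have mi : mu i 0 != 0 by apply: contraTneq h => ->; rewrite mulr0 ltxx.
  by rewrite /F; field.
have t0 : 0 <= t.
  have : 0 <= t * - (l j 0 * mu j 0) by rewrite /t FE // sqr_ge0.
  by rewrite pmulr_lge0 // oppr_gt0.
have l1_ge0 i : 0 <= l i 0 * l1 i 0.
  rewrite l1E mulrDr mulrCA -expr2.
  have [neg|pos] := ltP (l i 0 * mu i 0) 0; last first.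
    by apply: addr_ge0; [exact: sqr_ge0|exact: mulr_ge0].
  by rewrite -(FE i neg) mulrN -mulNr -mulrDl nmulr_lge0 // addrC subr_le0 jmin.
have l1S i : l i 0 = 0 -> l1 i 0 = 0 by move=> li; rewrite l1E muS // li mulr0 addr0.
have muj0 : mu j 0 != 0 by apply: contraTneq muj => ->; rewrite mulr0 ltxx.
have l1j : l1 j 0 = 0 by rewrite l1E /t /F; field.
have lj : l j 0 != 0 by apply: contra_neq muj0; exact: muS.
have [||l' [p1 p2 p3 p4 p5]] := IH l1.
- apply: leq_trans lN; apply: proper_card; apply/properP; split.
    by apply/fintype.subsetP => i; rewrite !inE; apply: contra => /eqP /l1S ->.
  by exists j; rewrite !inE ?lj // l1j eqxx.
(* The hypothesis passes to [l1], whose nonzero coordinates have the signs of those of [l]. *)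
- move=> nu nu0 nuS nug; have [i li] := Hl nu nu0 (fun i h => nuS i (l1S i h)) nug.
  exists i; have ni : nu i 0 != 0 by apply: contraTneq li => ->; rewrite mulr0 ltxx.
  have l1i : l1 i 0 != 0 by apply: contra_neq ni; exact: nuS.
  have l1i2 : 0 < l1 i 0 ^+ 2 by rewrite exprn_even_gt0.
  rewrite -(pmulr_llt0 _ l1i2) in li.
  have li1 : 0 < l i 0 * l1 i 0.
    rewrite lt_def l1_ge0 mulf_neq0 //.
    by apply: contraTneq li => ->; rewrite !mul0r ltxx.
  by rewrite -(pmulr_rlt0 _ li1); move: li; congr (_ < _); ring.
exists l'; split=> // [i|i /l1S /p2 //||].
- have [/p2 ->|l1i] := eqVneq (l1 i 0) 0; first by rewrite mulr0.
  have l1i2 : 0 < l1 i 0 ^+ 2 by rewrite exprn_even_gt0.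
  rewrite -(pmulr_lge0 _ l1i2).
  by have := mulr_ge0 (l1_ge0 i) (p1 i); congr (_ <= _); ring.
- by rewrite p3 mulmxDr -scalemxAr mu0 scaler0 addr0.
- by apply: le_trans p4; rewrite /l1 dotvDl dotvZl lerDl mulr_ge0.
Qed.

(** [E] projects onto the support of [l]. Each column of [E *m C] is a relation among the rows of
    [B] there, hence 0, so no compatibility condition restricts [g]. *)
Lemma indep_support_interp (R : fieldType) (p n : nat) (B : 'M[R]_(p, n))
    (l g : 'cV[R]_p) :
  indep_support B l ->
  exists y : 'cV[R]_n, forall i, l i 0 != 0 -> (B *m y) i 0 = g i 0.
Proof.
move=> ind; pose E : 'M[R]_p := diag_mx (\row_i (l i 0 != 0)%:R).
have EE q (M : 'M[R]_(p, q)) i j : (E *m M) i j = (l i 0 != 0)%:R * M i j.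
  by rewrite mul_diag_mx !mxE.
have Et : E^T = E by rewrite tr_diag_mx.
have : ((E *m g)^T <= (E *m B)^T)%MS.
  rewrite submxE !trmx_mul Et -!mulmxA; set C := cokermx _.
  suff -> : E *m C = 0 by rewrite mulmx0.
  apply/matrixP => i j; rewrite [RHS]mxE.
  suff /colP /(_ i) : col j (E *m C) = 0 by rewrite !mxE.
  apply: ind => [|k /eqP lk]; last by rewrite mxE EE lk mul0r.
  by rewrite colE mulmxA (mulmxA _ E) mulmx_coker mul0mx.
case/submxP => y yE; exists y^T => i li.
have /matrixP /(_ i 0) : E *m g = E *m (B *m y^T).
  by apply: trmx_inj; rewrite yE mulmxA [RHS]trmx_mul trmxK.
by rewrite !EE li !mul1r.
Qed.

(** * Euclidean norm and operator norm *)

Lemma eucl_normE (R : realType) (d : nat) (x : 'cV[R]_d) :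
  eucl_norm x = Num.sqrt (dotv x x).
Proof.
by rewrite /eucl_norm dotvE; congr Num.sqrt; apply: eq_bigr => i _; rewrite expr2.
Qed.

Lemma eucl_norm_ge0 (R : realType) (d : nat) (x : 'cV[R]_d) : 0 <= eucl_norm x.
Proof. exact: sqrtr_ge0. Qed.

Lemma sqr_eucl_norm (R : realType) (d : nat) (x : 'cV[R]_d) :
  eucl_norm x ^+ 2 = dotv x x.
Proof. by rewrite eucl_normE sqr_sqrtr // dotv_ge0. Qed.

Lemma eucl_norm_eq0 (R : realType) (d : nat) (x : 'cV[R]_d) :
  (eucl_norm x == 0) = (x == 0).
Proof. by rewrite -sqrf_eq0 sqr_eucl_norm dotv_eq0. Qed.

Lemma eucl_norm0 (R : realType) (d : nat) : eucl_norm (0 : 'cV[R]_d) = 0.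
Proof. by apply/eqP; rewrite eucl_norm_eq0. Qed.

Lemma eucl_normZ (R : realType) (d : nat) (a : R) (x : 'cV[R]_d) :
  eucl_norm (a *: x) = `|a| * eucl_norm x.
Proof.
by rewrite !eucl_normE dotvZl dotvZr mulrA -expr2 sqrtrM ?sqr_ge0 // sqrtr_sqr.
Qed.

Lemma cauchy_schwarz (R : realType) (d : nat) (u v : 'cV[R]_d) :
  dotv u v <= eucl_norm u * eucl_norm v.
Proof.
have [->|u0] := eqVneq u 0; first by rewrite dotvC dotv0r eucl_norm0 mul0r.
have [->|v0] := eqVneq v 0; first by rewrite dotv0r eucl_norm0 mulr0.
have Nu : 0 < eucl_norm u by rewrite lt_def eucl_norm_eq0 u0 eucl_norm_ge0.
have Nv : 0 < eucl_norm v by rewrite lt_def eucl_norm_eq0 v0 eucl_norm_ge0.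
have := dotv_ge0 (eucl_norm v *: u - eucl_norm u *: v).
rewrite dotvBl !dotvBr !dotvZl !dotvZr -!sqr_eucl_norm (dotvC v u).
set a := eucl_norm u in Nu *; set b := eucl_norm v in Nv *.
have -> : b * (b * a ^+ 2) - b * (a * dotv u v) -
   (a * (b * dotv u v) - a * (a * b ^+ 2)) = (2 * (a * b)) * (a * b - dotv u v).
  by ring.
by rewrite pmulr_rge0 ?subr_ge0 // !mulr_gt0.
Qed.

(** Coordinates of [x] in the unit ball are at most 1 in absolute value, so the absolute row sums of
    [M] bound the entries of [M *m x]. This rules out the default value of [sup]. *)
Lemma opnorm_has_sup (R : realType) (p q : nat) (M : 'M[R]_(p, q)) :
  has_sup [set eucl_norm (M *m x) | x in [set x : 'cV[R]_q | eucl_norm x <= 1]].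
Proof.
split; first by exists (eucl_norm (M *m 0)), 0 => //=; rewrite eucl_norm0 ler01.
exists (Num.sqrt (\sum_i (\sum_j `|M i j|) ^+ 2)) => _ [x /= x1 <-].
apply: ler_wsqrtr; apply: ler_sum => i _.
rewrite -real_normK ?num_real // lerXn2r ?nnegrE ?sumr_ge0 // mxE.
apply: le_trans (ler_norm_sum _ _ _) _; apply: ler_sum => j _.
rewrite normrM ler_piMr // -(ler_pXn2r (ltn0Sn 1)) ?nnegrE // expr1n.
rewrite real_normK ?num_real //.
apply: (@le_trans _ _ (eucl_norm x ^+ 2)); last first.
  by rewrite expr_le1 ?eucl_norm_ge0.
rewrite sqr_eucl_norm dotvE (bigD1 j) //= -expr2 lerDl sumr_ge0 // => k _.
by rewrite -expr2 sqr_ge0.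
Qed.

Lemma eucl_norm_mulmx (R : realType) (p q : nat) (M : 'M[R]_(p, q)) (x : 'cV[R]_q) :
  eucl_norm (M *m x) <= opnorm M * eucl_norm x.
Proof.
have [->|x0] := eqVneq x 0; first by rewrite mulmx0 !eucl_norm0 mulr0.
have Nx : 0 < eucl_norm x by rewrite lt_def eucl_norm_eq0 x0 eucl_norm_ge0.
rewrite -ler_pdivrMr //; apply: ub_le_sup; first by case: (opnorm_has_sup M).
exists ((eucl_norm x)^-1 *: x) => /=.
  by rewrite eucl_normZ ger0_norm ?invr_ge0 ?eucl_norm_ge0 // mulVf ?gt_eqF.
by rewrite -scalemxAr eucl_normZ ger0_norm ?invr_ge0 ?eucl_norm_ge0 // mulrC.
Qed.

Lemma opnorm_le (R : realType) (p q : nat) (M : 'M[R]_(p, q)) (c : R) :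
  (forall x, eucl_norm x <= 1 -> eucl_norm (M *m x) <= c) -> opnorm M <= c.
Proof.
move=> h; apply: ge_sup; first by case: (opnorm_has_sup M).
by move=> _ [x /= /h x1 <-].
Qed.

(** * Weighted least squares *)

Lemma dotv_diag (R : comNzRingType) (m : nat) (d : 'rV[R]_m) (u v : 'cV[R]_m) :
  dotv u (diag_mx d *m v) = \sum_i d 0 i * (u i 0 * v i 0).
Proof.
rewrite dotvE; apply: eq_bigr => i _.
by rewrite mul_diag_mx mxE mulrCA.
Qed.

Lemma full_rank_inj (R : fieldType) (m n : nat) (A : 'M[R]_(m, n)) (x : 'cV[R]_n) :
  \rank A = n -> A *m x = 0 -> x = 0.
Proof.
move=> rA Ax; apply: trmx_inj; apply: (row_free_inj (A := A^T)).
  by rewrite /row_free mxrank_tr rA.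
by rewrite -trmx_mul Ax !trmx0 mul0mx.
Qed.

(** A kernel vector [x] makes a sum of nonnegative terms vanish, so [A *m x = 0]. Hence [invmx] is a
    genuine inverse in [weighted_pinv]. *)
Lemma gram_unitmx (R : realFieldType) (m n : nat) (A : 'M[R]_(m, n)) (d : 'rV[R]_m) :
  \rank A = n -> (forall i, 0 < d 0 i) -> A^T *m diag_mx d *m A \in unitmx.
Proof.
move=> rA d0; rewrite -unitmx_tr -row_free_unit -kermx_eq0.
apply/eqP/row_matrixP => k; rewrite row0; apply: trmx_inj; rewrite trmx0.
set x := (row k _)^T.
have Gx : A^T *m (diag_mx d *m (A *m x)) = 0.
  rewrite !mulmxA; apply: trmx_inj; rewrite trmx_mul trmxK trmx0.
  by rewrite -row_mul mulmx_ker row0.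
apply: (full_rank_inj rA); apply/colP => i; rewrite [RHS]mxE.
have : dotv (A *m x) (diag_mx d *m (A *m x)) = 0.
  by rewrite dotvC -dotv_tr Gx dotvC dotv0r.
have ge0 j : 0 <= d 0 j * ((A *m x) j 0 * (A *m x) j 0).
  by rewrite mulr_ge0 ?(ltW (d0 j)) // -expr2 sqr_ge0.
rewrite dotv_diag => /psumr_eq0P h; have /eqP := h (fun j _ => ge0 j) i isT.
by rewrite mulf_eq0 gt_eqF //= mulf_eq0 orbb => /eqP.
Qed.

Lemma weighted_pinv_normal_eq (R : realType) (m n : nat) (A : 'M[R]_(m, n))
    (d : 'rV[R]_m) (g : 'cV[R]_m) :
  \rank A = n -> (forall i, 0 < d 0 i) ->
  A^T *m (diag_mx d *m (g - A *m (weighted_pinv A (diag_mx d) *m g))) = 0.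
Proof.
move=> rA d0; rewrite !mulmxBr /weighted_pinv !mulmxA.
by rewrite mulmxV ?mul1mx ?subrr // gram_unitmx.
Qed.

(** Pythagoras: by the normal equations the residual is orthogonal to the range of [A] for the
    weighted product. *)
Lemma weighted_pinv_lsq (R : realType) (m n : nat) (A : 'M[R]_(m, n))
    (d : 'rV[R]_m) (g : 'cV[R]_m) (y : 'cV[R]_n) :
  \rank A = n -> (forall i, 0 < d 0 i) ->
  \sum_i d 0 i * (g - A *m (weighted_pinv A (diag_mx d) *m g)) i 0 ^+ 2 <=
  \sum_i d 0 i * (g - A *m y) i 0 ^+ 2.
Proof.
move=> rA d0; set w := _ *m g; pose v := g - A *m w; pose z := A *m (w - y).
have -> : g - A *m y = v + z.
  by rewrite /v /z mulmxBr addrA subrK.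
have vz : \sum_i d 0 i * (z i 0 * v i 0) = 0.
  rewrite -dotv_diag dotvC -dotv_tr.
  by rewrite weighted_pinv_normal_eq // dotvC dotv0r.
rewrite -subr_ge0 -sumrB -/v.
have -> : \sum_i (d 0 i * (v + z) i 0 ^+ 2 - d 0 i * v i 0 ^+ 2) =
    2 * (\sum_i d 0 i * (z i 0 * v i 0)) + \sum_i d 0 i * z i 0 ^+ 2.
  rewrite mulr_sumr -big_split; apply: eq_bigr => i _ /=.
  by rewrite [(v + z) i 0]mxE; ring.
by rewrite vz mulr0 add0r sumr_ge0 // => i _; rewrite mulr_ge0 ?sqr_ge0 ?ltW.
Qed.

(* As the weights outside the support of [l] tend to 0, the weighted least
   squares solution interpolates [g] on that support. *)
Lemma dotv_le_weighted_pinv (R : realType) (m n : nat) (A : 'M[R]_(m, n)) (C : R)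
    (l g : 'cV[R]_m) :
  \rank A = n ->
  (forall D, posdiag_mx R m D -> opnorm (weighted_pinv A D) <= C) ->
  indep_support A l ->
  dotv l g <= C * eucl_norm (A^T *m l) * eucl_norm g.
Proof.
move=> rA hC ind; have [y yE] := indep_support_interp g ind.
pose K := \sum_(i | l i 0 == 0) (g - A *m y) i 0 ^+ 2.
have K0 : 0 <= K by apply: sumr_ge0 => i _; exact: sqr_ge0.
pose L := \sum_i `|l i 0|.
have L0 : 0 <= L by apply: sumr_ge0.
apply/ler_addgt0Pr => e e0.
(* [de] makes the error [L * de] at most [e], and [ep] makes [ep * K] at most [de ^+ 2]; adding 1
   keeps the denominators positive. *)
pose de := e / (L + 1).
have de0 : 0 < de by rewrite divr_gt0 // ltr_wpDl.
pose ep := de ^+ 2 / (K + 1).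
have ep0 : 0 < ep by rewrite divr_gt0 ?exprn_gt0 // ltr_wpDl.
pose d : 'rV[R]_m := \row_i (if l i 0 == 0 then ep else 1).
have d0 i : 0 < d 0 i by rewrite mxE; case: ifP.
pose w := weighted_pinv A (diag_mx d) *m g.
have wC : eucl_norm w <= C * eucl_norm g.
  apply: le_trans (eucl_norm_mulmx _ _) _; apply: ler_wpM2r; first exact: eucl_norm_ge0.
  by apply: hC; exists d.
have res i : l i 0 != 0 -> `|(g - A *m w) i 0| <= de.
  move=> li; rewrite -(ler_pXn2r (ltn0Sn 1)) ?nnegrE ?(ltW de0) //.
  rewrite real_normK ?num_real //.
  (* Coordinate [i] has weight 1, so its square is at most the minimal weighted sum, itself at most
     the sum at [y], where only terms of weight [ep] survive. *)
  apply: (@le_trans _ _ (\sum_j d 0 j * (g - A *m w) j 0 ^+ 2)).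
    rewrite (bigD1 i) //= [d 0 i]mxE (negbTE li) mul1r lerDl sumr_ge0 // => j _.
    by rewrite mulr_ge0 ?sqr_ge0 ?ltW.
  apply: le_trans (weighted_pinv_lsq g y rA d0) _.
  apply: (@le_trans _ _ (ep * K)); last first.
    by rewrite /ep -mulrA ler_piMr ?sqr_ge0 // mulrC ler_pdivrMr ?mul1r ?ltr_wpDl ?lerDl.
  rewrite /K mulr_sumr (bigID (fun j => l j 0 == 0)) /=.
  rewrite [X in _ + X]big1 ?addr0 => [|j lj].
    by apply: ler_sum => j lj; rewrite mxE lj.
  have := yE j lj; move: (A *m y) => v vj.
  by rewrite (_ : (g - v) j 0 = 0) ?expr0n ?mulr0 // 2!mxE vj subrr.
have -> : dotv l g = dotv (A^T *m l) w + dotv l (g - A *m w).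
  by rewrite dotv_tr -dotvDr addrC subrK.
apply: lerD.
  apply: le_trans (cauchy_schwarz _ _) _; rewrite [C * _]mulrC -mulrA.
  by rewrite ler_wpM2l ?eucl_norm_ge0.
apply: (@le_trans _ _ (L * de)).
  rewrite dotvE /L mulr_suml; apply: ler_sum => i _.
  apply: le_trans (ler_norm _) _; rewrite normrM.
  have [->|li] := eqVneq (l i 0) 0; first by rewrite normr0 !mul0r.
  by rewrite ler_wpM2l // res.
by rewrite /de mulrCA ler_piMr ?(ltW e0) // ler_pdivrMr ?mul1r ?ltr_wpDl ?lerDl.
Qed.

(** * Nearest points of polyhedra and KKT conditions *)

(** The distance is minimized over the compact part of the polyhedron in a box of radius [r] around
    [x]; points outside the box are farther from [x] than [y0]. *)
Lemma polyhedron_nearest (R : realType) (p n : nat) (B : 'M[R]_(p, n))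
    (b : 'cV[R]_p) (x : 'cV[R]_n) :
  polyhedron B b !=set0 ->
  exists y, polyhedron B b y /\
    forall z, polyhedron B b z -> dotv (x - y) (x - y) <= dotv (x - z) (x - z).
Proof.
move=> [y0 Py0].
pose f (v : 'rV[R]_n) : R := dotv (x - v^T) (x - v^T).
have fE v : f v = \sum_i (x i 0 - v 0 i) ^+ 2.
  by rewrite /f dotvE; apply: eq_bigr => i _; rewrite !mxE expr2.
pose r := eucl_norm (x - y0).
have r0 : 0 <= r by exact: eucl_norm_ge0.
pose box := [set v : 'rV[R]_n | forall i, v ord0 i \in `[x i 0 - r, x i 0 + r]].
have box_compact : compact box.
  apply: (@rV_compact _ _ (fun i => `[x i 0 - r, x i 0 + r]%classic)) => i.
  exact: segment_compact.
have sum_continuous (F : 'I_n -> 'rV[R]_n -> R) :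
    (forall j, continuous (F j)) -> continuous (fun v => \sum_j F j v).
  by move=> h; apply: continuous_big => [|j _]; [exact: add_continuous|exact: h].
pose K := [set v : 'rV[R]_n | polyhedron B b v^T] `&` box.
have K_compact : compact K.
  apply: (subclosed_compact _ box_compact); last by move=> v [].
  apply: closedI; last by apply: compact_closed => //; exact: norm_hausdorff.
  have -> : [set v : 'rV[R]_n | polyhedron B b v^T] =
      \bigcap_(i in [set: 'I_p]) [set v | \sum_j B i j * v 0 j <= b i 0].
    apply/seteqP; split=> v /= Pv i; [move=> _|]; have := Pv i.
      by rewrite mxE; under eq_bigr do rewrite mxE.
    by move/(_ I); rewrite mxE; under [X in _ -> X <= _]eq_bigr do rewrite mxE.
  apply: closed_bigI => i _.
  apply: (preimage_closed _ (@closed_le _ (b i 0))) => v _.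
  apply: (sum_continuous (fun j (v : 'rV[R]_n) => B i j * v 0 j)) => j {}v.
  by apply: (@continuousM _ _ (cst (B i j)) (fun v : 'rV[R]_n => v 0 j));
    [exact: cst_continuous|exact: coord_continuous].
have Ky0 : K y0^T.
  split; first by rewrite /= trmxK.
  move=> i /=; rewrite in_itv /= -ler_distlC mxE.
  rewrite -(ler_pXn2r (ltn0Sn 1)) ?nnegrE // real_normK ?num_real // /r sqr_eucl_norm.
  rewrite -[y0]trmxK -/(f _) fE (bigD1 i) //= !mxE -sqrrN opprB lerDl.
  by rewrite sumr_ge0 // => j _; exact: sqr_ge0.
have [||c] := @EVT_min_rV R n f K _ K_compact.
- by exists y0^T.
- apply: continuous_subspaceT => v.
  have -> : f = fun v => \sum_i (x i 0 - v 0 i) * (x i 0 - v 0 i).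
    by apply/funext => u; rewrite fE; apply: eq_bigr => i _; rewrite expr2.
  apply: (sum_continuous (fun i (v : 'rV[R]_n) => (x i 0 - v 0 i) * (x i 0 - v 0 i))).
  move=> i {}v.
  have h : {for v, continuous (fun v : 'rV[R]_n => x i 0 - v 0 i)}.
    by apply: (@continuousB _ _ _ (cst (x i 0)) (fun v : 'rV[R]_n => v 0 i));
      [exact: cst_continuous|exact: coord_continuous].
  exact: (continuousM h h).
rewrite inE => -[Pc _] cmin; exists c^T; split => // z Pz.
have [Kz|] := pselect (K z^T).
  by have := cmin z^T (mem_set Kz); rewrite /f trmxK.
move=> /not_andP [|/existsNP [i]]; first by rewrite /= trmxK.
move/negP; rewrite in_itv /= -ler_distlC -ltNge mxE => rz.
apply: (@le_trans _ _ (r ^+ 2)).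
  by have := cmin y0^T (mem_set Ky0); rewrite /f trmxK /r sqr_eucl_norm.
rewrite -[z]trmxK -/(f _) fE (bigD1 i) //= -(real_normK (num_real (_ - _))).
apply: (@le_trans _ _ (`|x i 0 - z^T 0 i| ^+ 2)).
  by rewrite lerXn2r ?nnegrE // mxE ltW // distrC.
by rewrite lerDl sumr_ge0 // => j _; exact: sqr_ge0.
Qed.

(** Farkas on the active rows: the alternative is a direction along which a short step stays
    feasible and comes closer to [x]. *)
Lemma nearest_kkt (R : realType) (p n : nat) (B : 'M[R]_(p, n))
    (b : 'cV[R]_p) (x y : 'cV[R]_n) :
  polyhedron B b y ->
  (forall z, polyhedron B b z -> dotv (x - y) (x - y) <= dotv (x - z) (x - z)) ->
  exists l : 'cV[R]_p, [/\ forall i, 0 <= l i 0,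
    forall i, (B *m y) i 0 != b i 0 -> l i 0 = 0 & x - y = B^T *m l].
Proof.
move=> Py ymin; pose J := [set i | (B *m y) i 0 == b i 0]%SET.
have [[l [l0 lJ xyE]]|[d [dJ cd]]] := farkas J B (x - y).
  by exists l; split=> // i yi; apply: lJ; rewrite inE.
exfalso; set c := x - y in ymin cd.
pose slack i := (b i 0 - (B *m y) i 0) / (`|(B *m d) i 0| + 1).
have slack_gt0 i : i \notin J -> 0 < slack i.
  move=> iJ; apply: divr_gt0; last by rewrite ltr_wpDl.
  rewrite subr_gt0 lt_def Py andbT.
  by move: iJ; rewrite inE eq_sym.
(* The slacks keep the inactive rows satisfied; the default term of the minimum makes the decrease
   [2 * t * dotv c d] exceed the increase [t ^+ 2 * dotv d d]. *)
pose t := \big[Order.min/(dotv c d / (dotv d d + 1))]_(i | i \notin J) slack i.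
have D0 : 0 < dotv d d + 1 by rewrite ltr_wpDl // dotv_ge0.
have t0 : 0 < t.
  by apply: lt_bigmin => //; exact: divr_gt0.
have Pt : polyhedron B b (y + t *: d).
  move=> i; rewrite mulmxDr -scalemxAr; have := Py i.
  have [iJ|iJ] := boolP (i \in J).
    have := dJ i iJ; move: (B *m y) (B *m d) => v w wi vi.
    by rewrite !mxE -[leRHS]addr0 lerD // mulr_ge0_le0 // ltW.
  have : t <= slack i by exact: bigmin_le_cond.
  rewrite /slack ler_pdivlMr ?ltr_wpDl //.
  move: (B *m y) (B *m d) => v w h _; rewrite !mxE -lerBrDl; apply: le_trans h.
  by rewrite ler_wpM2l ?(ltW t0) // (le_trans (ler_norm _)) // lerDl.
have := ymin _ Pt; rewrite leNgt => /negP; apply.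
rewrite opprD addrA -/c; clearbody c; rewrite dotvBl !dotvBr !dotvZl !dotvZr (dotvC d c).
have td : t * (dotv d d + 1) <= dotv c d.
  by rewrite -ler_pdivlMr //; exact: bigmin_le_id.
have : t * (t * (dotv d d + 1)) <= t * dotv c d by rewrite ler_pM2l.
have : 0 < t * dotv c d by rewrite mulr_gt0.
have := mulr_gt0 t0 t0.
rewrite mulrDr mulr1; move: (dotv c c) (dotv c d) (dotv d d) => cc q dd; nra.
Qed.

(** * Residuals, distances and bounds on the Hoffman constant *)

Lemma feasible_rhsP (R : realType) (p n : nat) (B : 'M[R]_(p, n)) (b : 'cV[R]_p) :
  feasible_rhs B b <-> polyhedron B b !=set0.
Proof.
split=> [[_ [x _ <-] [v v0 <-]]|[x Px]].
  by exists x => i; rewrite [leRHS]mxE lerDl v0.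
exists (B *m x); first by exists x.
exists (b - B *m x); last by rewrite addrC subrK.
by move=> i; have := Px i; move: (B *m x) => y; rewrite !mxE subr_ge0.
Qed.

Lemma pospartE (R : realType) (d : nat) (x : 'cV[R]_d) i :
  pospart x i 0 = Num.max (x i 0) 0.
Proof. by rewrite mxE. Qed.

Lemma dotv_pospart (R : realType) (d : nat) (x : 'cV[R]_d) :
  dotv (pospart x) (pospart x) = \sum_i Num.max (x i 0) 0 ^+ 2.
Proof. by rewrite dotvE; apply: eq_bigr => i _; rewrite pospartE expr2. Qed.

Lemma pospart_gt0 (R : realType) (p n : nat) (B : 'M[R]_(p, n)) (b : 'cV[R]_p) x :
  ~ polyhedron B b x -> 0 < eucl_norm (pospart (B *m x - b)).
Proof.
move=> nPx; rewrite lt_def eucl_norm_ge0 andbT eucl_norm_eq0.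
apply: contra_notN nPx => /eqP/colP h i; have := h i.
rewrite pospartE; move: (B *m x) => y; rewrite !mxE => /eqP.
by rewrite eq_maxr subr_le0.
Qed.

Lemma eucl_dist_le (R : realType) (d : nat) (x z : 'cV[R]_d) (T : set 'cV[R]_d) :
  T z -> eucl_dist x T <= eucl_norm (x - z).
Proof.
move=> Tz; apply: ge_inf; last by exists z.
by exists 0 => _ [v _ <-]; exact: eucl_norm_ge0.
Qed.

(** Nonemptiness matters: [inf] of the empty set is a default value. *)
Lemma le_eucl_dist (R : realType) (d : nat) (x : 'cV[R]_d) (T : set 'cV[R]_d) c :
  T !=set0 -> (forall z, T z -> c <= eucl_norm (x - z)) -> c <= eucl_dist x T.
Proof.
move=> [z Tz] h; apply: lb_le_inf; first by exists (eucl_norm (x - z)), z.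
by move=> _ [v Tv <-]; exact: h.
Qed.

Lemma hoffman_le (R : realType) (p n : nat) (B : 'M[R]_(p, n)) (M : \bar R) :
  (forall b x, polyhedron B b !=set0 -> ~ polyhedron B b x ->
    ((eucl_dist x (polyhedron B b) / eucl_norm (pospart (B *m x - b)))%:E <= M)%E) ->
  (hoffman B <= M)%E.
Proof.
by move=> h; apply: ge_ereal_sup => _ [[b x] /= [/feasible_rhsP Pb nPx] <-]; exact: h.
Qed.

Lemma le_hoffman (R : realType) (p n : nat) (B : 'M[R]_(p, n)) b x :
  polyhedron B b !=set0 -> ~ polyhedron B b x ->
  ((eucl_dist x (polyhedron B b) / eucl_norm (pospart (B *m x - b)))%:E <=
     hoffman B)%E.
Proof.
move=> Pb nPx; apply: ereal_sup_ubound; exists (b, x) => //=.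
by split => //; exact/feasible_rhsP.
Qed.

(** * Signed systems against the two-sided system *)

Lemma signature_mulmx (R : comNzRingType) (m n : nat) (A : 'M[R]_(m, n))
    (s : 'rV[R]_m) (x : 'cV[R]_n) i :
  (diag_mx s *m A *m x) i 0 = s 0 i * (A *m x) i 0.
Proof. by rewrite -mulmxA mul_diag_mx mxE. Qed.

(* A system [S A x <= b] is part of a two-sided system whose remaining
   bounds are loose at both [x] and a given feasible point. *)
Lemma hoffman_signature_le (R : realType) (m n : nat) (A : 'M[R]_(m, n))
    (s : 'rV[R]_m) :
  (forall i, s 0 i = -1 \/ s 0 i = 1) ->
  (hoffman (diag_mx s *m A) <= hoffman (col_mx A (- A)))%E.
Proof.
move=> hs; apply: hoffman_le => b x [y Py] nPx.
pose u : 'cV[R]_m := \col_i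
  if s 0 i == 1 then b i 0 else Num.max ((A *m y) i 0) ((A *m x) i 0).
pose v : 'cV[R]_m := \col_i
  if s 0 i == 1 then Num.max (- (A *m y) i 0) (- (A *m x) i 0) else b i 0.
have s1 : (-1 == 1 :> R) = false by rewrite lt_eqF // ltrN10.
have boldE z i : (col_mx A (- A) *m z) (lshift m i) 0 = (A *m z) i 0.
  by rewrite mul_col_mx col_mxEu.
have boldE' z i : (col_mx A (- A) *m z) (rshift m i) 0 = - (A *m z) i 0.
  by rewrite mul_col_mx col_mxEd mulNmx mxE.
have uE i : col_mx u v (lshift m i) 0 = u i 0 by rewrite col_mxEu.
have vE i : col_mx u v (rshift m i) 0 = v i 0 by rewrite col_mxEd.
have sub z : polyhedron (col_mx A (- A)) (col_mx u v) z ->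
    polyhedron (diag_mx s *m A) b z.
  move=> Pz i; rewrite signature_mulmx.
  have [si|si] := hs i.
    by have := Pz (rshift m i); rewrite boldE' vE [v _ _]mxE si s1 mulN1r.
  by have := Pz (lshift m i); rewrite boldE uE [u _ _]mxE si eqxx mul1r.
have Pby : polyhedron (col_mx A (- A)) (col_mx u v) y.
  move=> i; case: (split_ordP i) => j ->; have := Py j; rewrite signature_mulmx.
    rewrite boldE uE [u _ _]mxE; have [->|->] := hs j; rewrite ?s1 ?eqxx ?mul1r //.
    by rewrite le_max lexx.
  rewrite boldE' vE [v _ _]mxE; have [->|->] := hs j; rewrite ?s1 ?eqxx ?mulN1r //.
  by rewrite le_max lexx.
have nPbx : ~ polyhedron (col_mx A (- A)) (col_mx u v) x by move/sub.
apply: le_trans (le_hoffman _ nPbx); last by exists y.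
(* The added bounds hold at [x], hence contribute nothing to the residual. *)
have -> : eucl_norm (pospart (col_mx A (- A) *m x - col_mx u v)) =
          eucl_norm (pospart (diag_mx s *m A *m x - b)).
  rewrite !eucl_normE; congr Num.sqrt; rewrite !dotv_pospart big_split_ord /=.
  rewrite -big_split /=; apply: eq_bigr => i _.
  have -> : (col_mx A (- A) *m x - col_mx u v) (lshift m i) 0 = (A *m x) i 0 - u i 0.
    by rewrite -boldE -uE; move: (col_mx A (- A) *m x) (col_mx u v) => ? ?; rewrite !mxE.
  have -> : (col_mx A (- A) *m x - col_mx u v) (rshift m i) 0 = - (A *m x) i 0 - v i 0.
    by rewrite -boldE' -vE; move: (col_mx A (- A) *m x) (col_mx u v) => ? ?; rewrite !mxE.
  have -> : (diag_mx s *m A *m x - b) i 0 = s 0 i * (A *m x) i 0 - b i 0.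
    by rewrite -signature_mulmx; move: (_ *m x) => ?; rewrite !mxE.
  rewrite [u i 0]mxE [v i 0]mxE; move: (A *m x) (A *m y) => z w.
  have [->|->] := hs i; rewrite ?s1 ?eqxx ?mul1r ?mulN1r.
    rewrite [X in X ^+ 2 + _]max_r ?expr0n ?add0r //.
    by rewrite subr_le0 le_max lexx orbT.
  rewrite [X in _ + X ^+ 2]max_r ?expr0n ?addr0 //.
  by rewrite subr_le0 le_max lexx orbT.
(* By [sub] the two-sided polyhedron is the smaller one, so [x] is at least as far from it. *)
rewrite lee_fin ler_wpM2r ?invr_ge0 ?eucl_norm_ge0 //.
apply: le_eucl_dist; first by exists y.
by move=> z /sub Pz; exact: eucl_dist_le.
Qed.

(** * The two inequalities between [chi] and the Hoffman constants *)

Lemma opnorm_ge0 (R : realType) (p q : nat) (M : 'M[R]_(p, q)) : 0 <= opnorm M.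
Proof.
apply: ub_le_sup; first by case: (opnorm_has_sup M).
by exists 0; rewrite /= ?mulmx0 eucl_norm0 ?ler01.
Qed.

Lemma hoffman_two_sided_le (R : realType) (m n : nat) (A : 'M[R]_(m, n)) (C : R) :
  \rank A = n ->
  (forall D, posdiag_mx R m D -> opnorm (weighted_pinv A D) <= C) ->
  (hoffman (col_mx A (- A)) <= C%:E)%E.
Proof.
move=> rA hC; apply: hoffman_le => b x Pb nPx; rewrite lee_fin.
rewrite ler_pdivrMr ?pospart_gt0 //; set B := col_mx A (- A) in Pb nPx *.
have C0 : 0 <= C.
  apply: le_trans (opnorm_ge0 _) (hC (diag_mx (const_mx 1)) _).
  by exists (const_mx 1) => //= i; rewrite mxE ltr01.
have [y [Py ymin]] := polyhedron_nearest x Pb.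
have [l [l0 lS xyE]] := nearest_kkt Py ymin.
apply: le_trans (eucl_dist_le x Py) _.
set r := pospart _.
pose lm := usubmx l - dsubmx l.
have xyE' : x - y = A^T *m lm.
  rewrite xyE /B tr_col_mx -{1}[l]vsubmxK mul_row_col linearN /= mulNmx.
  by rewrite -mulmxBr.
(* With the zero vector as objective the hypothesis is vacuous; the reduction serves to make the
   support independent while keeping signs. *)
have [mu _ _|l' [l'1 l'2 l'3 _ ind]] := @caratheodory R m n A 0 lm.
  by rewrite dotv0r ltxx.
(* The sign of [l'] selects which of the two residuals of row [i] is kept, negated for the lower
   block. *)
pose g : 'cV[R]_m :=
  \col_i if 0 <= l' i 0 then r (lshift m i) 0 else - r (rshift m i) 0.
have BE z i : (B *m z) (lshift m i) 0 = (A *m z) i 0.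
  by rewrite mul_col_mx col_mxEu.
have BE' z i : (B *m z) (rshift m i) 0 = - (A *m z) i 0.
  by rewrite mul_col_mx col_mxEd mulNmx mxE.
have r_ge i : (B *m x) i 0 - b i 0 <= r i 0.
  rewrite pospartE; move: (B *m x) => z; rewrite !mxE le_max lexx //.
have lmE i : lm i 0 = l (lshift m i) 0 - l (rshift m i) 0 by rewrite !mxE.
have le1 : dotv l' (A *m (x - y)) <= dotv l' g.
  rewrite !dotvE; apply: ler_sum => i _.
  rewrite mulmxBr [g i 0]mxE.
  have -> : (A *m x - A *m y) i 0 = (A *m x) i 0 - (A *m y) i 0.
    by move: (A *m x) (A *m y) => ? ?; rewrite !mxE.
  have [pos|neg|->] := ltrgt0P (l' i 0); last by rewrite !mul0r.
    rewrite ler_wpM2l ?(ltW pos) //.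
    (* A nonzero multiplier means, by complementary slackness, that [y] attains this bound. *)
    have lu : l (lshift m i) 0 != 0.
      have : 0 <= lm i 0 by rewrite -(pmulr_lge0 _ pos) l'1.
      have : lm i 0 != 0 by apply: contraTneq pos => /l'2 ->; rewrite ltxx.
      rewrite lmE => h1 h2; apply/eqP => lu; have := l0 (rshift m i); lra.
    have := contra_neq_eq (lS (lshift m i)) lu.
    by move: (r_ge (lshift m i)); rewrite !BE => h ->.
  rewrite ler_wnM2l ?(ltW neg) //.
  have lu : l (rshift m i) 0 != 0.
    have : lm i 0 <= 0 by rewrite -(nmulr_lge0 _ neg) l'1.
    have : lm i 0 != 0 by apply: contraTneq neg => /l'2 ->; rewrite ltxx.
    rewrite lmE => h1 h2; apply/eqP => lu; have := l0 (lshift m i); lra.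
  have := contra_neq_eq (lS (rshift m i)) lu.
  by move: (r_ge (rshift m i)); rewrite !BE' => h yE; lra.
have gr : eucl_norm g <= eucl_norm r.
  rewrite !eucl_normE; apply: ler_wsqrtr; rewrite !dotvE big_split_ord /=.
  rewrite -big_split /=; apply: ler_sum => i _; rewrite mxE.
  case: ifP => _; rewrite ?mulrNN -!expr2 ?lerDl ?lerDr sqr_ge0 //.
have xy0 : 0 < eucl_norm (x - y).
  rewrite lt_def eucl_norm_ge0 andbT eucl_norm_eq0 subr_eq0.
  by apply: contra_notN nPx => /eqP ->.
(* After multiplication by the norm of [x - y], the left side is [dotv l' (A *m (x - y))]. *)
rewrite -(ler_pM2l xy0) -expr2 sqr_eucl_norm {1}xyE' -l'3 dotv_tr.
apply: le_trans le1 _.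
apply: le_trans (dotv_le_weighted_pinv g rA hC ind) _.
rewrite l'3 -xyE' mulrAC mulrC ler_wpM2l ?eucl_norm_ge0 //.
by rewrite ler_wpM2l.
Qed.

(* With [u := (A^T D A)^-1 w], the multipliers [l := D A u] satisfy [A^T l = w]
   and [<l, g> = |w|^2]; a kernel element [mu <> 0] of [A^T] supported
   where [l] is cannot have the signs of [l], because [<mu, A u> = 0], so
   Caratheodory's reduction applies. *)
Lemma weighted_pinv_le_hoffman (R : realType) (m n : nat) (A : 'M[R]_(m, n))
    (d : 'rV[R]_m) (g : 'cV[R]_m) :
  \rank A = n -> (forall i, 0 < d 0 i) ->
  let w := weighted_pinv A (diag_mx d) *m g in
  w != 0 ->
  exists u : 'cV[R]_n, forall s : 'rV[R]_m,
    (forall i, s 0 i = -1 \/ s 0 i = 1) ->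
    (forall i, (A *m u) i 0 != 0 -> 0 < s 0 i * (A *m u) i 0) ->
    ((eucl_norm w / eucl_norm g)%:E <= hoffman (diag_mx s *m A))%E.
Proof.
move=> rA d0 w w0.
pose u := invmx (A^T *m diag_mx d *m A) *m w.
exists u => s hs hsu.
pose l := diag_mx d *m (A *m u).
have lE i : l i 0 = d 0 i * (A *m u) i 0 by rewrite /l mul_diag_mx mxE.
have lw : A^T *m l = w.
  by rewrite /l !mulmxA mulmxV ?mul1mx // gram_unitmx.
have lg : dotv l g = eucl_norm w ^+ 2.
  have <- : dotv l (A *m w) = eucl_norm w ^+ 2 by rewrite -dotv_tr lw sqr_eucl_norm.
  apply/eqP; rewrite -subr_eq0 -dotvBr /l dotvC.
  suff -> : dotv (g - A *m w) (diag_mx d *m (A *m u)) =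
            dotv (A^T *m (diag_mx d *m (g - A *m w))) u.
    by rewrite weighted_pinv_normal_eq // dotvC dotv0r.
  by rewrite dotv_tr [RHS]dotvC !dotv_diag; apply: eq_bigr => i _;
    rewrite [_ * _ i 0]mulrC.
have [mu mu0 muS mug|l' [l'1 l'2 l'3 l'4 ind]] := @caratheodory R m n A g l.
  have [[i li]|/forallNP h] := pselect (exists i, l i 0 * mu i 0 < 0).
    by exists i.
  exfalso; have ge0 i : 0 <= (A *m u) i 0 * mu i 0.
    have /negP := h i; rewrite -leNgt lE -mulrA.
    by rewrite pmulr_rge0.
  have : \sum_i (A *m u) i 0 * mu i 0 = 0.
    by rewrite -dotvE dotvC -dotv_tr mu0 dotvC dotv0r.
  move=> /psumr_eq0P => /(_ (fun i _ => ge0 i)) z.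
  suff mu00 : mu = 0 by move: mug; rewrite mu00 dotvC dotv0r ltxx.
  apply/colP => i; rewrite mxE; have /eqP := z i isT.
  rewrite mulf_eq0 => /orP [/eqP ui|/eqP //].
  by apply: muS; rewrite lE ui mulr0.
have [y yE] := indep_support_interp (- g) ind.
(* [s] carries the signs of [l'], which are those of [l] and of [A *m u]. *)
have sl i : `|l' i 0| * s 0 i = l' i 0.
  have [->|li] := eqVneq (l' i 0) 0; first by rewrite normr0 mul0r.
  have l0 : l i 0 != 0 by apply: contra_neq li; exact: l'2.
  have ui : (A *m u) i 0 != 0 by apply: contra_neq l0 => e; rewrite lE e mulr0.
  have := hsu i ui; have := l'1 i; rewrite lE -mulrA pmulr_rge0 //.
  have [->|->] := hs i; rewrite ?mulN1r ?mul1r => h1 h2.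
    rewrite oppr_gt0 in h2; rewrite nmulr_rge0 // in h1.
    by rewrite ler0_norm // mulrN1 opprK.
  by rewrite pmulr_rge0 // in h1; rewrite ger0_norm // mulr1.
(* On the support of [l'] the bounds are tight at [y]; elsewhere they are loose enough for both [y]
   and 0. *)
pose b : 'cV[R]_m := \col_i
  if l' i 0 != 0 then - (s 0 i * g i 0) else Num.max (s 0 i * (A *m y) i 0) 0.
have Py : polyhedron (diag_mx s *m A) b y.
  move=> i; rewrite signature_mulmx [b i 0]mxE; case: ifP => li.
    by rewrite yE // mxE mulrN.
  by rewrite le_max lexx.
have dist z : polyhedron (diag_mx s *m A) b z -> eucl_norm w <= eucl_norm (0 - z).
  move=> Pz; have Nw : 0 < eucl_norm w by rewrite lt_def eucl_norm_eq0 w0 eucl_norm_ge0.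
  rewrite -(ler_pM2l Nw); apply: le_trans (cauchy_schwarz _ _).
  rewrite sub0r dotvC dotvNl dotvC -lw -l'3 dotv_tr -expr2.
  rewrite l'3 lw -lg; apply: le_trans l'4 _.
  rewrite -dotvNl !dotvE; apply: ler_sum => i _; rewrite [(- l') i 0]mxE mulNr.
  have [->|li] := eqVneq (l' i 0) 0; first by rewrite !mul0r oppr0.
  have := Pz i; rewrite signature_mulmx [b i 0]mxE li -(sl i) -!mulrA => h.
  by rewrite -mulrN ler_wpM2l // lerNr.
have nP0 : ~ polyhedron (diag_mx s *m A) b 0.
  move/dist; rewrite subr0 eucl_norm0 leNgt => /negP; apply.
  by rewrite lt_def eucl_norm_eq0 w0 eucl_norm_ge0.
apply: le_trans (le_hoffman _ nP0); last by exists y.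
have r0 := pospart_gt0 nP0.
rewrite lee_fin; apply: ler_pM; rewrite ?invr_ge0 ?eucl_norm_ge0 //.
  by apply: le_eucl_dist => //; exists y.
(* The residual at 0 is the positive part of [- b]: at most the absolute value of [g i 0] on the
   support, and 0 off it. *)
have rg : eucl_norm (pospart (diag_mx s *m A *m 0 - b)) <= eucl_norm g.
  rewrite !eucl_normE; apply: ler_wsqrtr; rewrite dotv_pospart dotvE.
  apply: ler_sum => i _; rewrite mulmx0 sub0r [(- b) i 0]mxE [b i 0]mxE.
  rewrite -expr2; case: ifP => li; last first.
    by rewrite max_r ?expr0n ?sqr_ge0 // oppr_le0 le_max lexx orbT.
  rewrite opprK -[leRHS]mul1r.
  have <- : s 0 i ^+ 2 = 1 by have [->|->] := hs i; rewrite ?sqrrN expr1n.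
  rewrite -exprMn; case: (leP _ 0) => // _.
  by rewrite expr0n sqr_ge0.
by rewrite lef_pV2 ?posrE // (lt_le_trans r0).
Qed.

(** * Perturbation to nonzero entries *)

(** Induction on the number of zero entries of [A *m u]: a short step along row [k] makes entry [k]
    a positive multiple of the squared norm of that row and preserves the signs of the nonzero
    entries. *)
Lemma nonvanishing_perturbation (R : realFieldType) (m n : nat) (A : 'M[R]_(m, n))
    (u : 'cV[R]_n) :
  (forall i, row i A != 0) ->
  exists v : 'cV[R]_n, forall i,
    (A *m v) i 0 != 0 /\ ((A *m u) i 0 != 0 -> 0 < (A *m u) i 0 * (A *m v) i 0).
Proof.
move=> hA.
have [N] := ubnP #|[set i | (A *m u) i 0 == 0]%SET|.
elim: N => // N IH in u *; rewrite ltnS => uN.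
have [k /eqP uk|h] := pickP (fun i => (A *m u) i 0 == 0); last first.
  exists u => i; split; first by rewrite h.
  by move=> ui; rewrite -expr2 exprn_even_gt0.
pose z := (row k A)^T.
(* The added 1 avoids division by 0 and makes the change of each nonzero entry strictly smaller than
   the entry. *)
pose F i := `|(A *m u) i 0| / (`|(A *m z) i 0| + 1).
pose t := \big[Order.min/1]_(i | (A *m u) i 0 != 0) F i.
have t0 : 0 < t.
  apply: lt_bigmin => // i ui; apply: divr_gt0; first by rewrite normr_gt0.
  by rewrite ltr_wpDl.
have AE i : (A *m (u + t *: z)) i 0 = (A *m u) i 0 + t * (A *m z) i 0.
  by rewrite mulmxDr -scalemxAr; move: (A *m u) (A *m z) => ? ?; rewrite !mxE.
have same i : (A *m u) i 0 != 0 -> 0 < (A *m u) i 0 * (A *m (u + t *: z)) i 0.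
  move=> ui; rewrite AE.
  have : t <= F i by exact: bigmin_le_cond.
  rewrite /F ler_pdivlMr ?ltr_wpDl // mulrDr mulr1 => h.
  have : `|t * (A *m z) i 0| < `|(A *m u) i 0|.
    rewrite normrM gtr0_norm //; apply: lt_le_trans h; by rewrite ltrDl.
  move: (t * _) => a; move: {h} ui; move: ((A *m u) i 0) => c c0 ac.
  rewrite mulrDr -expr2 -real_normK ?num_real // -[_ * a]opprK subr_gt0.
  apply: le_lt_trans (ler_norm _) _; rewrite normrN normrM expr2.
  by rewrite ltr_pM2l // normr_gt0.
have kk : (A *m (u + t *: z)) k 0 != 0.
  rewrite AE uk add0r mulf_neq0 ?gt_eqF //.
  have -> : (A *m z) k 0 = dotv z z.
    by rewrite /dotv trmxK mulmx_row_coord [RHS]mxE eqxx mulr1n.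
  by rewrite lt_def dotv_ge0 andbT dotv_eq0 trmx_eq0.
have [|v hv] := IH (u + t *: z).
  apply: leq_trans uN; apply: proper_card; apply/properP; split.
    apply/fintype.subsetP => i; rewrite !inE; apply: contraTT => /same.
    by apply: contraTneq => ->; rewrite mulr0 ltxx.
  by exists k; rewrite !inE ?uk.
exists v => i; have [h1 h2] := hv i; split=> // ui.
have h3 := same i ui.
have h4 : (A *m (u + t *: z)) i 0 != 0.
  by apply: contraTneq h3 => ->; rewrite mulr0 ltxx.
have h5 : 0 < (A *m (u + t *: z)) i 0 ^+ 2 by rewrite exprn_even_gt0.
rewrite -(pmulr_lgt0 _ h5).
by have := mulr_gt0 h3 (h2 h4); congr (_ < _); ring.
Qed.

(** * Extended-real bounds and attained maxima *)

Lemma hoffman_two_sided_le_chi (R : realType) (m n : nat) (A : 'M[R]_(m, n)) :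
  \rank A = n -> (hoffman (col_mx A (- A)) <= chi A)%E.
Proof.
move=> rA.
have h D : posdiag_mx R m D -> ((opnorm (weighted_pinv A D))%:E <= chi A)%E.
  by move=> hD; apply: ereal_sup_ubound; exists D.
(* An infinite [chi A] is trivial, and minus infinity is excluded by the identity weights. *)
case: (chi A) h => [c||] h; last 2 first.
- exact: leey.
- have hI : posdiag_mx R m (diag_mx (const_mx 1)).
    by exists (const_mx 1) => //= i; rewrite mxE ltr01.
  by have := h _ hI; rewrite leeNy_eq.
- by apply: hoffman_two_sided_le => // D /h; rewrite lee_fin.
Qed.

(** As [s] may depend on [u] and is free where [A *m u] vanishes, the criterion serves both families
    of signatures. *)
Lemma chi_le (R : realType) (m n : nat) (A : 'M[R]_(m, n)) (M : \bar R) :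
  (0 < n)%N -> \rank A = n ->
  (forall u : 'cV[R]_n, exists s : 'rV[R]_m,
    [/\ forall i, s 0 i = -1 \/ s 0 i = 1,
        forall i, (A *m u) i 0 != 0 -> 0 < s 0 i * (A *m u) i 0
      & (hoffman (diag_mx s *m A) <= M)%E]) ->
  (chi A <= M)%E.
Proof.
move=> n0 rA hM.
have key (d : 'rV[R]_m) (g : 'cV[R]_m) :
    (forall i, 0 < d 0 i) -> weighted_pinv A (diag_mx d) *m g != 0 ->
    ((eucl_norm (weighted_pinv A (diag_mx d) *m g) / eucl_norm g)%:E <= M)%E.
  move=> d0 w0; have [u hu] := weighted_pinv_le_hoffman rA d0 w0.
  have [s [s1 s2 s3]] := hM u; exact: le_trans (hu s s1 s2) s3.
(* This covers a vanishing image of [g]. The pseudo-inverse sends [A *m const_mx 1] back to the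
   all-ones vector, nonzero as [0 < n]. *)
have M0 : (0 <= M)%E.
  have d0 i : 0 < (const_mx 1 : 'rV[R]_m) 0 i by rewrite mxE ltr01.
  have := key (const_mx 1) (A *m const_mx 1) d0.
  have -> : weighted_pinv A (diag_mx (const_mx 1)) *m (A *m const_mx 1) =
      (const_mx 1 : 'cV[R]_n).
    rewrite /weighted_pinv; set G := _ *m A.
    rewrite -(mulmxA (invmx G)) -(mulmxA (invmx G)) (mulmxA _ A) mulKmx //.
    exact: gram_unitmx.
  move=> h.
  apply: le_trans (h _); first by rewrite lee_fin divr_ge0 ?eucl_norm_ge0.
  apply/eqP => /colP /(_ (Ordinal n0)); rewrite !mxE => /eqP.
  by rewrite oner_eq0.
apply: ge_ereal_sup => _ [_ [d /= d0 <-] <-].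
case: M {hM} M0 key => [c||] M0 key; [|exact: leey|by []].
rewrite lee_fin; apply: opnorm_le => g g1.
have [->|w0] := eqVneq (weighted_pinv A (diag_mx d) *m g) 0.
  by rewrite eucl_norm0 -lee_fin.
have := key d g d0 w0; rewrite lee_fin; apply: le_trans.
have g0 : 0 < eucl_norm g.
  rewrite lt_def eucl_norm_ge0 andbT eucl_norm_eq0.
  by apply: contra_neq w0 => ->; rewrite mulmx0.
by rewrite ler_pdivlMr // ler_piMr ?eucl_norm_ge0.
Qed.

Lemma chi_is_max (R : realType) (m n : nat) (A : 'M[R]_(m, n))
    (Q : set 'M[R]_m) :
  (0 < n)%N -> \rank A = n -> Q `<=` signature_mx R m ->
  (forall u : 'cV[R]_n, exists s : 'rV[R]_m,
    [/\ forall i, s 0 i = -1 \/ s 0 i = 1,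
        forall i, (A *m u) i 0 != 0 -> 0 < s 0 i * (A *m u) i 0
      & Q (diag_mx s)]) ->
  is_max [set hoffman (S *m A) | S in Q] (chi A).
Proof.
move=> n0 rA Qs hQ.
have ub : ubound [set hoffman (S *m A) | S in Q] (chi A).
  move=> _ [S /Qs [s /= hs <-] <-].
  exact: le_trans (hoffman_signature_le A hs) (hoffman_two_sided_le_chi rA).
split => //.
(* Encoding signatures by a finite type yields a maximizer over [Q]. *)
pose sg (f : {ffun 'I_m -> bool}) : 'rV[R]_m := \row_i if f i then -1 else 1.
have sgP (s : 'rV[R]_m) : (forall i, s 0 i = -1 \/ s 0 i = 1) -> exists f, s = sg f.
  move=> hs; exists [ffun i => s 0 i == -1]; apply/rowP => i; rewrite mxE ffunE.
  by have [->|->] := hs i; rewrite ?eqxx // eq_sym lt_eqF // ltrN10.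
have [s0 [hs0 _ Qs0]] := hQ 0; have [f0 sE] := sgP s0 hs0.
pose P f := `[< Q (diag_mx (sg f)) >].
have Pf0 : P f0 by apply/asboolP; rewrite -sE.
have [f /asboolP Qf fmax] :=
  @arg_maxP _ _ _ f0 P (fun f => hoffman (diag_mx (sg f) *m A)) Pf0.
exists (diag_mx (sg f)) => //; apply/eqP; rewrite eq_le; apply/andP; split.
  by apply: ub; exists (diag_mx (sg f)).
apply: chi_le => // u; have [s [s1 s2 s3]] := hQ u.
exists s; split => //; have [f' sE'] := sgP s s1; rewrite sE'; apply: fmax.
by apply/asboolP; rewrite -sE'.
Qed.

Theorem theorem2 (R : realType) (m n : nat) (hm : (0 < m)%N) (hn : (0 < n)%N)
    (A : 'M[R]_(m, n)) (hA : \rank A = n) :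
  [/\ is_max [set hoffman (S *m A) | S in signature_mx R m] (chi A),
      chi A = hoffman (col_mx A (- A))
    & (forall i : 'I_m, row i A != 0) ->
      is_max [set hoffman (S *m A) | S in
                [set S | signature_mx R m S
                       /\ mximage (S *m A) `&` pos_vec R m !=set0]]
             (chi A)].
Proof.
pose sgn (u : 'cV[R]_n) : 'rV[R]_m := \row_i if (A *m u) i 0 < 0 then -1 else 1.
have sgn1 u i : sgn u 0 i = -1 \/ sgn u 0 i = 1.
  by rewrite mxE; case: ifP; [left|right].
have sgnP u i : (A *m u) i 0 != 0 -> 0 < sgn u 0 i * (A *m u) i 0.
  rewrite [sgn u 0 i]mxE => ui; case: (ltP ((A *m u) i 0) 0) => h.
    by rewrite mulN1r oppr_gt0.
  by rewrite mul1r lt_def ui.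
have max1 : is_max [set hoffman (S *m A) | S in signature_mx R m] (chi A).
  apply: chi_is_max => // u; exists (sgn u).
  by split; [exact: sgn1|exact: sgnP|exists (sgn u)].
split => //.
  (* [chi A] is attained at some signature, whose Hoffman constant is at most the two-sided one. *)
  apply/eqP; rewrite eq_le hoffman_two_sided_le_chi // andbT.
  have [[_ [s /= hs <-] <-] _] := max1; exact: (hoffman_signature_le A hs).
move=> rowA; apply: chi_is_max => // [S [] //|u].
(* The signs of [A *m v] extend those of [A *m u], and [v] itself witnesses the positive image. *)
have [v hv] := nonvanishing_perturbation u rowA.
exists (sgn v); split => // [i ui|].
  have [vi /(_ ui) uv] := hv i.
  have v2 : 0 < (A *m v) i 0 ^+ 2 by rewrite exprn_even_gt0.
  rewrite -(pmulr_lgt0 _ v2); have := mulr_gt0 (sgnP v i vi) uv.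
  by congr (_ < _); ring.
split; first by exists (sgn v).
exists (diag_mx (sgn v) *m A *m v); split; first by exists v.
by move=> i; rewrite signature_mulmx; apply: sgnP; case: (hv i).
Qed.
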